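(* Let $q$ be a prime power and let $a,b$ be relatively prime integers with $1<a<b$. The regularity set of $Y=\mathbb{P}(1,a,b)(\mathbb{F}_q)$ is $$\mathrm{reg}(Y)=\{d\in\mathbb{N}: d=d_0ab\text{ with } d_0\ge q\}=qab+\mathbb{N}ab.$$
   Context: $\mathbb{P}(1,a,b)=(\mathbb{K}^3\setminus\{0\})/\mathbb{K}^*$ with $\mathbb{K}=\overline{\mathbb{F}_q}$ and $\lambda\in\mathbb{K}^*$ acting by $(x_0,x_1,x_2)\mapsto(\lambda x_0,\lambda^ax_1,\lambda^bx_2)$. $Y=\mathbb{P}(1,a,b)(\mathbb{F}_q)$ is the set of classes having a representative in $\mathbb{F}_q^3$; $|Y|=q^2+q+1$. $S=\mathbb{F}_q[x_0,x_1,x_2]$ is graded by $\deg x_0=1,\deg x_1=a,\deg x_2=b$; $I(Y)$ is the ideal generated by the homogeneous polynomials vanishing on $Y$, $I_d(Y)=I(Y)\cap S_d$, and $H_Y(d)=\dim_{\mathbb{F}_q}S_d-\dim_{\mathbb{F}_q}I_d(Y)$. The regularity set is $\mathrm{reg}(Y)=\{d\in\mathbb{N}: H_Y(d)=|Y|\}$; here $0\in\mathbb{N}$. *)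

(* Defs.v *)
From HB Require Import structures.
From mathcomp Require Import all_boot all_order all_algebra all_field.
From mathcomp Require Import finmap generic_quotient mpoly.
From mathcomp Require Import boolp classical_sets cardinality.

Set Implicit Arguments.
Unset Strict Implicit.
Unset Printing Implicit Defensive.

Import GRing.Theory.
Local Open Scope ring_scope.
Local Open Scope quotient_scope.
Local Open Scope classical_set_scope.

Definition weight (a b : nat) : 'I_3 -> nat := tnth [tuple 1; a; b]%N.

Definition wdeg (a b : nat) (m : 'X_{1..3}) : nat :=
  (\sum_(i < 3) m i * weight a b i)%N.

Lemma wdeg0 a b : wdeg a b 0%MM = 0%N.
Proof. by rewrite /wdeg big1 // => i _; rewrite mnm0E mul0n. Qed.

Lemma wdegD a b : {morph wdeg a b : m1 m2 / (m1 + m2)%MM >-> (m1 + m2)%N}.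
Proof.
move=> m1 m2; rewrite /wdeg -big_split /=.
by apply: eq_bigr => i _; rewrite mnmDE mulnDl.
Qed.

HB.instance Definition _ a b := isMeasure.Build 3 (wdeg a b) (wdeg0 a b) (wdegD a b).

Section WeightedProjectivePlane.
Variables (K : fieldType) (a b : nat).

Definition nzvec := {x : 'rV[K]_3 | x != 0}.

Definition wequiv (x y : nzvec) : bool :=
  `[< exists2 l : K, l != 0 &
      forall i, val y 0 i = l ^+ weight a b i * val x 0 i >].

Lemma wequiv_refl : reflexive wequiv.
Proof.
move=> x; apply/asboolP; exists 1; first exact: oner_neq0.
by move=> i; rewrite expr1n mul1r.
Qed.

Lemma wequiv_sub x y : wequiv x y -> wequiv y x.
Proof.
move=> /asboolP[l l0 exy]; apply/asboolP; exists l^-1; first by rewrite invr_eq0.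
by move=> i; rewrite exy mulrA -exprMn mulVf // expr1n mul1r.
Qed.

Lemma wequiv_sym : ssrbool.symmetric wequiv.
Proof. by move=> x y; apply/idP/idP => /wequiv_sub. Qed.

Lemma wequiv_trans : transitive wequiv.
Proof.
move=> y x z /asboolP[l l0 exy] /asboolP[k k0 eyz]; apply/asboolP.
exists (k * l); first by rewrite mulf_neq0.
by move=> i; rewrite eyz exy mulrA exprMn.
Qed.

Canonical wequiv_equivRel :=
  EquivRel wequiv wequiv_refl wequiv_sym wequiv_trans.

Definition wproj := {eq_quot wequiv_equivRel}.

HB.instance Definition _ := Quotient.on wproj.
HB.instance Definition _ := Choice.on wproj.

End WeightedProjectivePlane.

(* Number of elements of a finite set; 0 on infinite sets. *)
Definition set_card (T : choiceType) (A : set T) : nat := #|` fset_set A|%fset.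

Section Dimension.
Variables (k : fieldType) (V : lmodType k).

Definition has_dim (W : set V) (n : nat) : Prop :=
  exists e : 'I_n -> V,
    [/\ forall i, W (e i),
        forall c : 'I_n -> k, \sum_i c i *: e i = 0 -> forall i, c i = 0 &
        forall v, W v -> exists c : 'I_n -> k, v = \sum_i c i *: e i].

(* Dimension of a linear subspace W of V; 0 if W is not finite-dimensional. *)
Definition dim (W : set V) : nat := xget 0%N [set n | has_dim W n].

End Dimension.

Definition ideal_gen (R : comNzRingType) (G : set R) : set R :=
  [set f | exists (n : nat) (c g : 'I_n -> R),
     (forall i, G (g i)) /\ f = \sum_i c i * g i].

Section RationalPoints.
Variables (F K : fieldType) (iota : {rmorphism F -> K}) (a b : nat).

(* P(1,a,b)(F), inside P(1,a,b) over K *)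
Definition rational_points : set (wproj K a b) :=
  [set P | exists x : nzvec K,
     P = \pi_(wproj K a b) x /\ exists u : 'rV[F]_3, val x = map_mx iota u].

(* For homogeneous f this does not depend on the representative x of P. *)
Definition vanishes_at (f : {mpoly F[3]}) (P : wproj K a b) : Prop :=
  forall x : nzvec K, \pi_(wproj K a b) x = P ->
    (map_mpoly iota f).@[fun i => val x 0 i] = 0.

Definition graded_piece (d : nat) : set {mpoly F[3]} :=
  [set f | f \is d.-homog for (wdeg a b)].

Definition vanishing_ideal (Y : set (wproj K a b)) : set {mpoly F[3]} :=
  ideal_gen [set f | (exists d, graded_piece d f) /\
                     forall P, Y P -> vanishes_at f P].

Definition hilbert (Y : set (wproj K a b)) (d : nat) : int :=
  (dim (graded_piece d))%:Z - (dim (vanishing_ideal Y `&` graded_piece d))%:Z.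

Definition regularity_set (Y : set (wproj K a b)) : set nat :=
  [set d | hilbert Y d = (set_card Y)%:Z].

End RationalPoints.

Arguments rational_points {F K} iota a b _.

(* Main.v *)
(* H_Y(d) is the rank of the evaluation map from S_d to the functions on (chosen
   representatives of) Y, so d is regular iff for every point of Y some form of
   degree d is nonzero there and vanishes at all the other points.

   Separating (0:1:0) requires a monomial x1^i of degree d, and (0:0:1) a monomial
   x2^j; hence ab | d, say d = d0 ab. On the line x0 = 0 a form of degree d is then a
   binary form of degree d0 in U = x1^b and V = x2^a, and V/U identifies the rational
   points of the line with P^1(F_q); a form that vanishes at all of them but (0:1:0)
   has q zeros, so d0 >= q.

   Conversely let d0 >= q. Since a + b <= ab, the degree d exceeds (a + b)(q - 1), so the
   indicator of any affine point (1:s:t), of degree (a + b)(q - 1), can be multiplied by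
   a positive power of x0. Points of the line are separated by binary forms in U and V,
   whose values off the line are then cancelled by affine indicators. *)
Require Import Defs.
From HB Require Import structures.
From mathcomp Require Import all_boot all_order all_algebra all_field.
From mathcomp Require Import finmap generic_quotient mpoly.
From mathcomp Require Import zify.
From mathcomp Require Import boolp classical_sets cardinality.

Set Implicit Arguments.
Unset Strict Implicit.
Unset Printing Implicit Defensive.

Import GRing.Theory.
Local Open Scope ring_scope.
Local Open Scope classical_set_scope.

(** * Dimension of subspaces and rank-nullity *)

Section Rank.
Variables (k : fieldType) (V : lmodType k).
Implicit Types W : set V.

Lemma sum_scale_mulmx n p (c : 'I_n -> k) (P : 'M[k]_(n, p)) (e : 'I_p -> V) :
  \sum_i c i *: (\sum_j P i j *: e j) = \sum_j ((\row_i c i) *m P) 0 j *: e j.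
Proof.
under eq_bigr do rewrite scaler_sumr.
rewrite exchange_big; apply: eq_bigr => j _ /=.
by rewrite mxE scaler_suml; apply: eq_bigr => i _; rewrite mxE scalerA.
Qed.

(** Writing [e'] in terms of [e] gives an n' by n matrix whose rows are independent because [e'] is
    free, so its rank n' is at most n. *)
Lemma has_dim_leq W n n' : has_dim W n -> has_dim W n' -> (n' <= n)%N.
Proof.
move=> [e [_ _ spanW]] [e' [eW' free' _]].
have [c cE] := choice (fun i => spanW _ (eW' i)).
pose P : 'M_(n', n) := \matrix_(i, j) c i j.
have e'E i : e' i = \sum_j P i j *: e j.
  by rewrite cE; apply: eq_bigr => j _; rewrite mxE.
suff /eqP <- : row_free P by apply: rank_leq_col.
rewrite -kermx_eq0; apply/rowV0P => u /sub_kermxP uP0.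
apply/rowP => i; rewrite mxE; apply: free' i.
under eq_bigr do rewrite e'E.
rewrite sum_scale_mulmx (_ : \row_i u 0 i = u); last by apply/rowP => i; rewrite mxE.
by rewrite uP0 big1 // => j _; rewrite mxE scale0r.
Qed.

Lemma has_dimE W n : has_dim W n -> Defs.dim W = n.
Proof.
move=> dW; apply: xget_unique => // n' dW'.
by apply/eqP; rewrite eqn_leq (has_dim_leq dW dW') (has_dim_leq dW' dW).
Qed.

(** Rank-nullity: r is the rank of the matrix [A] of [phi] on a basis of [W], and a basis of the row
    kernel of [A] gives one of the kernel. [W] is a bare set, hence the explicit closure
    hypothesis. *)
Lemma has_dim_ker m (phi : {linear V -> 'rV[k]_m}) W n :
    (forall p (c : 'I_p -> k) (e : 'I_p -> V),
      (forall i, W (e i)) -> W (\sum_i c i *: e i)) -> has_dim W n ->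
  exists r, [/\ (r <= n)%N, has_dim (W `&` [set v | phi v = 0]) (n - r) &
    r = m <-> forall y, exists2 v, W v & phi v = y].
Proof.
move=> linW [e [eW free span]].
pose A : 'M_(n, m) := \matrix_i phi (e i).
have phiE (u : 'rV_n) : phi (\sum_j u 0 j *: e j) = u *m A.
  rewrite linear_sum mulmx_sum_row; apply: eq_bigr => j _.
  by rewrite linearZ rowK.
have spanV v : W v -> exists u : 'rV_n, v = \sum_j u 0 j *: e j.
  move=> /span[c ->]; exists (\row_j c j).
  by apply: eq_bigr => j _; rewrite mxE.
exists (\rank A); split; first exact: rank_leq_row.
  rewrite -mxrank_ker; have [B Bfree Bker] :
      exists2 B : 'M_(\rank (kermx A), n), row_free B & (B :=: kermx A)%MS.
    by exists (row_base (kermx A)); [exact: row_base_free | exact: eq_row_base].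
  exists (fun i => \sum_j B i j *: e j); split.
  - move=> i; split => /=; first exact: linW.
    rewrite (_ : \sum_j B i j *: e j = \sum_j row i B 0 j *: e j); last first.
      by apply: eq_bigr => j _; rewrite mxE.
    rewrite phiE; apply/sub_kermxP.
    by rewrite -Bker row_sub.
  - move=> c; rewrite sum_scale_mulmx => /free cB i.
    have /eqP : (\row_i c i) *m B = 0 by apply/rowP => j; rewrite cB mxE.
    rewrite mulmx_free_eq0 // => /eqP/rowP/(_ i).
    by rewrite !mxE.
  - move=> v [/spanV[u ->] /= ]; rewrite phiE => /sub_kermxP.
    rewrite -Bker => /submxP[c ->].
    exists (c 0); rewrite sum_scale_mulmx.
    by rewrite (_ : \row_i c 0 i = c) //; apply/rowP => i; rewrite mxE.
split=> [rA y|sur].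
  have /submxP[u ->] : (y <= A)%MS by apply: submx_full; apply/eqP.
  by exists (\sum_j u 0 j *: e j); rewrite ?phiE //; apply: linW.
apply/eqP; rewrite -[_ == _]/(row_full A) -sub1mx; apply/row_subP => i.
have [v /spanV[u ->] <-] := sur (row i 1%:M).
by rewrite phiE submxMl.
Qed.

End Rank.

(** * Coordinates and weighted homogeneous polynomials *)

Lemma ord3P (P : 'I_3 -> Prop) : P 0 -> P 1 -> P 2%:R -> forall i, P i.
Proof.
move=> P0 P1 P2 i; case: i => -[|[|[|//]]] lti.
- by rewrite (_ : Ordinal lti = 0) //; apply: val_inj.
- by rewrite (_ : Ordinal lti = 1) //; apply: val_inj.
- by rewrite (_ : Ordinal lti = 2%:R) //; apply: val_inj.
Qed.

Lemma big_ord3 (T : Type) (idx : T) (op : Monoid.law idx) (f : 'I_3 -> T) :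
  \big[op/idx]_i f i = op (op (f 0) (f 1)) (f 2%:R).
Proof.
have e1 : lift ord0 ord0 = 1 :> 'I_3 by apply: val_inj.
have e2 : lift ord0 (lift ord0 ord0) = 2%:R :> 'I_3 by apply: val_inj.
by rewrite !big_ord_recl big_ord0 Monoid.mulm1 Monoid.mulmA e1 e2.
Qed.

Section Weights.
Variables (a b : nat).
Hypotheses (a_gt0 : (0 < a)%N) (b_gt0 : (0 < b)%N).

Lemma wdegE (m : 'X_{1..3}) :
  wdeg a b m = (m 0%R + m 1%R * a + m 2%:R * b)%N.
Proof.
by rewrite /wdeg big_ord3 muln1.
Qed.

(** The monomials of weighted degree d form a basis; they are finitely many because positive weights
    bound the ordinary degree by d. *)
Lemma has_dim_graded_piece (k : fieldType) d :
  exists n, has_dim (@graded_piece k a b d) n.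
Proof.
pose ms : seq 'X_{1..3} :=
  [seq val m | m <- enum {: 'X_{1..3 < d.+1}} & wdeg a b (val m) == d].
have ms_uniq : uniq ms.
  rewrite map_inj_uniq; last by move=> m1 m2 /val_inj.
  by rewrite filter_uniq // enum_uniq.
have msP m : (m \in ms) = (wdeg a b m == d).
  apply/mapP/idP => [[m' + ->]|dm]; first by rewrite mem_filter => /andP[].
  have md : (mdeg m < d.+1)%N.
    rewrite ltnS -(eqP dm) mdegE /wdeg; apply: leq_sum => i _.
    rewrite leq_pmulr //.
    by case: i => -[|[|[|]]].
  by exists (BMultinom md); rewrite // mem_filter dm mem_enum.
pose t := in_tuple ms; exists (size ms), (fun i => 'X_[tnth t i]); split.
- by move=> i; rewrite /graded_piece /= dhomogX -msP mem_tnth.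
- move=> c /(congr1 (fun f => f@_(tnth t _))) c0 i.
  move: (c0 i); rewrite mcoeff0 raddf_sum (bigD1 i) //= mcoeffZ mcoeffX eqxx mulr1.
  rewrite big1 ?addr0 // => j ji; rewrite mcoeffZ mcoeffX.
  by rewrite (inj_eq (tuple_uniqP t ms_uniq)) (negbTE ji) mulr0.
- move=> f /dhomogP fd; exists (fun i => f@_(tnth t i)).
  rewrite -(big_tuple _ _ t xpredT (fun m => f@_m *: 'X_[m])) {1}[f]mpolyE.
  have sub : {subset msupp f <= ms} by move=> m /fd /eqP; rewrite -msP.
  rewrite [RHS](bigID (mem (msupp f))) /= [X in _ + X]big1 => [|m]; last first.
    by move=> /memN_msupp_eq0 ->; rewrite scale0r.
  rewrite addr0 -[RHS]big_filter; apply: perm_big; apply: uniq_perm => //.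
    exact: filter_uniq.
  by move=> m; rewrite mem_filter; case: (boolP (_ \in msupp f)) => //= /sub ->.
Qed.

Lemma meval_dhomog (R : comNzRingType) (f : {mpoly R[3]}) d (l : R) (v w : 'I_3 -> R) :
    f \is d.-homog for (wdeg a b) ->
  (forall i, w i = l ^+ weight a b i * v i) -> f.@[w] = l ^+ d * f.@[v].
Proof.
move=> /dhomogP fd wE; rewrite !mevalE mulr_sumr; apply: eq_big_seq => m /fd dm.
rewrite mulrCA; congr (_ * _); rewrite -dm /= /wdeg -prodrXr -big_split.
by apply: eq_bigr => i _; rewrite wE exprMn -exprM mulnC.
Qed.

End Weights.

Lemma meval_map_mpoly (F K : fieldType) (h : {rmorphism F -> K}) n
    (f : {mpoly F[n]}) (v : 'I_n -> F) :
  (map_mpoly h f).@[h \o v] = h f.@[v].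
Proof.
rewrite (mevalE v f) {1}[f]mpolyE (raddf_sum (map_mpoly h)) !raddf_sum /=; apply: eq_bigr => m _ /=.
rewrite map_mpolyZ map_mpolyX mevalZ mevalX rmorphM rmorph_prod.
by congr (_ * _); apply: eq_bigr => i _; rewrite rmorphXn.
Qed.

Lemma dhomog_map_mpoly (F K : fieldType) (h : {rmorphism F -> K}) n
    (mf : measure n) d (f : {mpoly F[n]}) :
  f \is d.-homog for mf -> map_mpoly h f \is d.-homog for mf.
Proof.
move=> /dhomogP fd; apply/dhomogP => m.
by rewrite (perm_mem (msupp_map_mpoly _ (fmorph_inj h))) => /fd.
Qed.

(** * Rational points and the evaluation criterion for regularity *)

Section Regularity.
Variables (F : finFieldType) (K : fieldType) (h : {rmorphism F -> K}).
Variables (a b : nat).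
Hypotheses (a_gt0 : (0 < a)%N) (b_gt0 : (0 < b)%N).

(** The scalar ranges over [K], not over [F]: (0,1,0) and (0,s,0) with s nonzero are one point even
    when s has no a-th root in [F]. *)
Definition same_point (u v : 'rV[F]_3) : Prop :=
  exists2 l : K, l != 0 & forall i, h (v 0 i) = l ^+ weight a b i * h (u 0 i).

Definition nzvec_of (k : fieldType) (u : 'rV[k]_3) (u0 : u != 0) : nzvec k :=
  exist _ u u0.

Lemma map_mx_nz (u : nzvec F) : map_mx h (val u) != 0.
Proof. by rewrite map_mx_eq0 (valP u). Qed.

Definition rational_point (u : nzvec F) : wproj K a b :=
  \pi_(wproj K a b)%qT (nzvec_of (map_mx_nz u)).

Lemma rational_pointsE : rational_points h a b = range rational_point.
Proof.
apply/seteqP; split=> P.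
  move=> [x [-> [u xu]]].
  have u0 : u != 0 by rewrite -(map_mx_eq0 h) -xu (valP x).
  exists (nzvec_of u0) => //; rewrite /rational_point; congr (\pi_(wproj K a b)%qT _).
  exact/val_inj.
move=> [u _ <-]; exists (nzvec_of (map_mx_nz u)); split => //.
by exists (val u).
Qed.

Lemma pi_wprojP (x y : nzvec K) :
  (\pi_(wproj K a b)%qT x = \pi_(wproj K a b)%qT y) <->
  exists2 l : K, l != 0 & forall i, val y 0 i = l ^+ weight a b i * val x 0 i.
Proof.
by split=> [/eqmodP/asboolP | ?] //; apply/eqmodP/asboolP.
Qed.

Lemma rational_point_eq u v :
  rational_point u = rational_point v <-> same_point (val u) (val v).
Proof.
rewrite /rational_point pi_wprojP /same_point /=.
split=> -[l l0 lP]; exists l => // i; first by have := lP i; rewrite !mxE.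
by rewrite !mxE.
Qed.

Lemma meval_same_point d (f : {mpoly F[3]}) (u v : 'rV[F]_3) :
  graded_piece a b d f -> same_point u v ->
  f.@[u 0] = 0 -> f.@[v 0] = 0.
Proof.
move=> fd [l l0 lP] fu; apply: (fmorph_inj h).
rewrite rmorph0 -meval_map_mpoly.
have hfd := dhomog_map_mpoly h fd.
by rewrite (meval_dhomog hfd lP) (meval_map_mpoly h f (u 0)) fu rmorph0 mulr0.
Qed.

(** Vanishing passes from the generators to their combinations. Conversely such an f is itself a
    generator: homogeneity carries its zeros to all representatives over [K]. *)
Lemma vanishing_idealE d (f : {mpoly F[3]}) : graded_piece a b d f ->
  vanishing_ideal h (rational_points h a b) f <->
  forall u : 'rV[F]_3, u != 0 -> f.@[u 0] = 0.
Proof.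
move=> fd; split=> [[n [c [g [gY ->]]]] u u0|f0].
  rewrite raddf_sum big1 //= => i _; rewrite mevalM.
  have [_ /(_ (rational_point (nzvec_of u0)))] := gY i.
  rewrite rational_pointsE => /(_ (imageT _ _)) /(_ _ erefl) /= gi.
  have : h (g i).@[u 0] = 0.
    rewrite -meval_map_mpoly -[RHS]gi; apply: meval_eq => j /=.
    by rewrite mxE.
  by move/eqP; rewrite fmorph_eq0 => /eqP ->; rewrite mulr0.
exists 1%N, (fun _ => 1), (fun _ => f); split; last by rewrite big_ord1 mul1r.
move=> _; split; first by exists d.
move=> P; rewrite rational_pointsE => -[u _ <-] x /esym /pi_wprojP[l l0 lP].
have hfd := dhomog_map_mpoly h fd.
have lP' i : val x 0 i = l ^+ weight a b i * h (val u 0 i).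
  by rewrite lP /= mxE.
rewrite (meval_dhomog hfd lP') (meval_map_mpoly h f (val u 0)).
by rewrite f0 ?(valP u) // rmorph0 mulr0.
Qed.

Lemma regularity_setP d :
  regularity_set h (rational_points h a b) d <->
  forall u : 'rV[F]_3, u != 0 -> exists f,
    [/\ graded_piece a b d f, f.@[u 0] != 0 &
        forall v, v != 0 -> ~ same_point u v -> f.@[v 0] = 0].
Proof.
set Y := rational_points h a b.
have finY : finite_set Y.
  by rewrite /Y rational_pointsE; apply: finite_image; apply: finite_finset.
pose r := enum_fset (fset_set Y).
have rP P : P \in r <-> Y P.
  by rewrite -[P \in r]/(P \in fset_set Y) in_fset_set // inE.
have /choice[rep repP] : forall i : 'I_(size r),
    exists u : nzvec F, rational_point u = tnth (in_tuple r) i.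
  move=> i; have /rP := mem_tnth i (in_tuple r).
  by rewrite /Y rational_pointsE => -[u _ <-]; exists u.
have repS u : exists i, rational_point (rep i) = rational_point u.
  have : rational_point u \in in_tuple r.
    by apply/rP; rewrite /Y rational_pointsE; exact: imageT.
  by move=> /tnthP[i uE]; exists i; rewrite repP.
have rep_inj i j : rational_point (rep i) = rational_point (rep j) -> i = j.
  by rewrite !repP; apply/tuple_uniqP; exact: fset_uniq.
have [phi phiE] : exists phi : {linear {mpoly F[3]} -> 'rV[F]_(size r)},
    forall f i, phi f 0 i = f.@[val (rep i) 0].
  pose ev (f : {mpoly F[3]}) : 'rV[F]_(size r) := \row_i f.@[val (rep i) 0].
  have ev_lin : linear ev.
    by move=> c f g; apply/rowP => i; rewrite !mxE mevalD mevalZ.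
  pose phi : {linear {mpoly F[3]} -> 'rV[F]_(size r)} :=
    HB.pack ev (GRing.isLinear.Build _ _ _ _ ev ev_lin).
  by exists phi => f i; rewrite mxE.
have ev0 d' f : graded_piece a b d' f -> phi f = 0 ->
    forall u : 'rV[F]_3, u != 0 -> f.@[u 0] = 0.
  move=> fd f0 u u0; have [i /rational_point_eq] := repS (nzvec_of u0).
  by move=> /(meval_same_point fd); apply; rewrite -phiE f0 mxE.
have [n nP] := has_dim_graded_piece a_gt0 b_gt0 F d.
have [|s [sn sP sE]] := has_dim_ker phi _ nP.
  by move=> p c e We; apply: rpred_sum => i _; apply: rpredZ; exact: We.
(* A form that vanishes at the chosen representatives vanishes at every nonzero vector over [F], so
   the kernel of [phi] in degree d is I_d(Y). *)
have kerE : vanishing_ideal h Y `&` graded_piece a b d =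
    graded_piece a b d `&` [set f | phi f = 0].
  apply/seteqP; split=> f.
    move=> [+ fd]; move=> /(vanishing_idealE fd) f0; split => //=.
    by apply/rowP => i; rewrite phiE mxE f0 // (valP (rep i)).
  by move=> [fd /= f0]; split => //; apply/(vanishing_idealE fd); apply: (ev0 d).
rewrite /regularity_set /= /hilbert kerE (has_dimE nP) (has_dimE sP).
rewrite -[set_card Y]/(size r) subzn ?leq_subr // subKn //.
split.
  move=> [/sE sur] u u0; have [i iu] := repS (nzvec_of u0).
  (* A preimage of the unit vector at the point of [u] is a separating form. *)
  have [f fd fE] := sur (\row_j (j == i)%:R); exists f; split => //.
    apply/eqP => fu; have /(meval_same_point fd)/(_ fu) : same_point u (val (rep i)).
      by apply/(rational_point_eq (nzvec_of u0)).
    by rewrite -phiE fE mxE eqxx; apply/eqP/oner_neq0.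
  move=> v v0 uv; have [j jv] := repS (nzvec_of v0).
  apply: (@meval_same_point _ _ (val (rep j))) fd _ _.
    exact/(rational_point_eq _ (nzvec_of v0)).
  rewrite -phiE fE mxE; case: eqP => // ji; case: uv.
  by apply/(rational_point_eq (nzvec_of u0) (nzvec_of v0)); rewrite -iu -ji.
move=> ind; congr Posz; apply/sE => y.
have /choice[f fP] : forall i : 'I_(size r), exists f : {mpoly F[3]},
    [/\ graded_piece a b d f, phi f 0 i != 0 &
        forall j, j != i -> phi f 0 j = 0].
  move=> i.
  have [fi [fd fi0 fiv]] := ind _ (valP (rep i)); exists fi; split => //.
    by rewrite phiE.
  move=> j ji; rewrite phiE fiv ?(valP (rep j)) // => /rational_point_eq /rep_inj ij.
  by rewrite ij eqxx in ji.
(* Lagrange interpolation with the separating forms. *)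
exists (\sum_i (y 0 i / phi (f i) 0 i) *: f i).
  by apply: rpred_sum => i _; apply: rpredZ; case: (fP i).
rewrite linear_sum; apply/rowP => j; rewrite summxE (bigD1 j) //= big1 => [|i ij].
  by rewrite addr0 linearZ mxE; case: (fP j) => _ fj _; rewrite divfK.
by rewrite linearZ mxE; have [_ _ fij] := fP i; rewrite (fij j) ?mulr0 // eq_sym.
Qed.

End Regularity.

(** * Powers and roots in fields, and Fermat's identity *)

(** With the Bezout relation ia = jb + 1, the scalar l = x^i / y^j works. It lies in the field of x
    and y, so no root is extracted. *)
Lemma bezout_pow (K : fieldType) (a b : nat) (x y : K) : (0 < a)%N ->
    coprime a b -> x != 0 -> y != 0 -> y ^+ a = x ^+ b ->
  exists l, [/\ l != 0, l ^+ a = x & l ^+ b = y].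
Proof.
move=> a_gt0 /eqP ab x0 y0 yx; case: (egcdnP b a_gt0) => i j; rewrite ab => ij _.
exists (x ^+ i / y ^+ j); split.
- by rewrite mulf_neq0 ?invr_eq0 ?expf_neq0.
- rewrite exprMn exprVn -!exprM ij [(j * a)%N]mulnC (exprM y) yx -exprM mulnC.
  by rewrite exprD expr1 mulrC mulKf ?expf_neq0 // mulnC.
- rewrite exprMn exprVn -!exprM [(i * b)%N]mulnC (exprM x) -yx -exprM.
  by rewrite [(a * i)%N]mulnC ij exprD expr1 mulrC mulKf ?expf_neq0.
Qed.

Lemma closed_root (K : closedFieldType) n (c : K) : (0 < n)%N ->
  exists x : K, x ^+ n = c.
Proof.
move=> n_gt0.
have /closed_rootP[x] : size ('X^n - c%:P) != 1%N.
  by rewrite size_XnsubC // eqSS -lt0n.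
rewrite rootE !hornerE => /eqP /subr0_eq xc; by exists x.
Qed.

Lemma fermat_pred (F : finFieldType) (x : F) : x ^+ #|F|.-1 = (x != 0)%:R.
Proof.
have q1 : (0 < #|F|.-1)%N by rewrite -ltnS prednK ?finNzRing_gt1 // (ltn_trans _ (finNzRing_gt1 F)).
have [->|x0] := eqVneq x 0; first by rewrite expr0n gtn_eqF.
apply: (mulfI x0); rewrite -exprS prednK ?mulr1 ?expf_card //.
by rewrite (ltn_trans _ (finNzRing_gt1 F)).
Qed.

(** The power of y is the indicator of y != 0, and the two powers of x agree as functions: their
    exponents differ by a multiple of q - 1 and, since q <= d0, both are positive. *)
Lemma corner_form (F : finFieldType) (x y : F) d0 m n : (#|F| <= d0)%N -> (0 < m)%N -> (0 < n)%N ->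
  x ^+ (m * d0) - x ^+ (m * (d0 - #|F|.-1)) * y ^+ (n * #|F|.-1) =
  (y == 0)%:R * x ^+ (m * d0).
Proof.
move=> qd m0 n0; have q1 : (1 < #|F|)%N := finNzRing_gt1 F.
rewrite [(n * _)%N]mulnC (exprM y) fermat_pred.
have [_|_] := eqVneq y 0.
  by rewrite /= expr0n (gtn_eqF n0) mulr0 subr0 mul1r.
rewrite /= expr1n mulr1 mul0r; have [->|x0] := eqVneq x 0.
  rewrite !expr0n !muln_eq0 subn_eq0 !(gtn_eqF m0) /=.
  have -> : (d0 == 0%N) = false by lia.
  have -> : (d0 <= #|F|.-1)%N = false by lia.
  by rewrite subrr.
rewrite -{1}(subnK (n := d0) (m := #|F|.-1)) ?mulnDr; last by lia.
by rewrite exprD [(m * #|F|.-1)%N]mulnC (exprM x #|F|.-1) fermat_pred x0 expr1n mulr1 subrr.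
Qed.

(** * Affine indicators and extension of forms from the line x0 = 0 *)

Section Forms.
Variables (F : finFieldType) (a b : nat).
Hypotheses (a_gt1 : (1 < a)%N) (lt_ab : (a < b)%N).
Local Notation q := #|F|.

Definition pt (x y z : F) : 'I_3 -> F := tnth [tuple x; y; z].

(** The coordinate x0 has weight 1, so rescaling by it reaches the chart x0 = 1 within [F]. *)
Lemma meval_normalize d (f : {mpoly F[3]}) (v : 'I_3 -> F) :
    graded_piece a b d f -> v 0 != 0 ->
  f.@[v] = v 0 ^+ d * f.@[pt 1 (v 1 / v 0 ^+ a) (v 2%:R / v 0 ^+ b)].
Proof.
move=> fd v0; apply: meval_dhomog fd _.
by apply: ord3P; rewrite /weight /pt /tnth /= ?expr1 ?mulr1 // mulrC divfK ?expf_neq0.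
Qed.

Lemma dhomog_var (i : 'I_3) :
  ('X_i : {mpoly F[3]}) \is (weight a b i).-homog for (wdeg a b).
Proof.
rewrite dhomogX /= /wdeg (bigD1 i) //= big1 => [|j ji].
  by rewrite mnm1E eqxx mul1n addn0.
by rewrite mnm1E eq_sym (negbTE ji).
Qed.

Lemma dhomog_varX (i : 'I_3) n :
  ('X_i ^+ n : {mpoly F[3]}) \is (weight a b i * n).-homog for (wdeg a b).
Proof. exact/dhomogMn/dhomog_var. Qed.

Lemma degree_bound d0 : (q <= d0)%N -> ((a + b) * q.-1 < d0 * a * b)%N.
Proof.
move=> qd; have q1 : (1 < q)%N := finNzRing_gt1 F.
(* This is (a - 1)(b - 1) >= 1; then (a + b)(q - 1) <= ab(q - 1) < ab d0. *)
have ab : (a + b <= a * b)%N by nia.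
nia.
Qed.

Lemma affine_indicator d (s t : F) : ((a + b) * q.-1 < d)%N ->
  exists f, [/\ graded_piece a b d f, forall v, v 0 = 0 -> f.@[v] = 0 &
    forall y z, f.@[pt 1 y z] = ((y == s) && (z == t))%:R].
Proof.
(* On [F], [1 - w ^+ q.-1] is the indicator of [w = 0]. *)
move=> dq; exists ('X_0 ^+ (d - (a + b) * q.-1) *
  ('X_0 ^+ (a * q.-1) - ('X_1 - s *: 'X_0 ^+ a) ^+ q.-1) *
  ('X_0 ^+ (b * q.-1) - ('X_(2%:R) - t *: 'X_0 ^+ b) ^+ q.-1)); split.
- have h0 n : ('X_0 ^+ n : {mpoly F[3]}) \is n.-homog for (wdeg a b).
    by have := dhomog_varX 0 n; rewrite mul1n.
  rewrite /graded_piece /=; set p := _ * _.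
  suff : p \is (d - (a + b) * q.-1 + a * q.-1 + b * q.-1).-homog for (wdeg a b).
    by rewrite -addnA -mulnDl subnK // ltnW.
  apply: dhomogM; first apply: dhomogM => //.
    apply: rpredB => //; apply: dhomogMn; apply: rpredB; first exact: (dhomog_var 1).
    exact: rpredZ.
  apply: rpredB => //; apply: dhomogMn; apply: rpredB; first exact: (dhomog_var 2%:R).
  exact: rpredZ.
(* The bound [dq] is strict, so the leading power of ['X_0] has a positive exponent. *)
- by move=> v v0; rewrite !mevalM rmorphXn /= mevalXU v0 expr0n subn_eq0 leqNgt dq !mul0r.
- move=> y z; rewrite !(mevalM, mevalB, mevalZ, rmorphXn) /=.
  rewrite !(mevalB, mevalZ, rmorphXn) /= !mevalXU.
  rewrite /pt /tnth /= !expr1n !mulr1 mul1r !fermat_pred !subr_eq0.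
  by case: (y == s); case: (z == t); rewrite /= ?subrr ?subr0 ?mulr0 ?mulr1.
Qed.

(* The indicators subtracted below are divisible by ['X_0] since [d] exceeds
   [(a + b) * q.-1], so the values of [g] on the line are not affected. *)
Lemma line_extension d (g : {mpoly F[3]}) : ((a + b) * q.-1 < d)%N ->
    graded_piece a b d g ->
  exists f, [/\ graded_piece a b d f, forall v, v 0 = 0 -> f.@[v] = g.@[v] &
    forall v, v 0 != 0 -> f.@[v] = 0].
Proof.
move=> dq gd.
have /choice[e eP] : forall st : F * F, exists f, [/\ graded_piece a b d f,
    forall v, v 0 = 0 -> f.@[v] = 0 &
    forall y z, f.@[pt 1 y z] = ((y == st.1) && (z == st.2))%:R].
  by move=> st; exact: affine_indicator.
exists (g - \sum_st g.@[pt 1 st.1 st.2] *: e st).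
have fd : graded_piece a b d (g - \sum_st g.@[pt 1 st.1 st.2] *: e st).
  apply: rpredB => //; apply: rpred_sum => st _; apply: rpredZ.
  by case: (eP st).
split=> // v v0.
  rewrite mevalB (raddf_sum (meval v)) big1 ?subr0 //= => st _.
  by rewrite mevalZ; case: (eP st) => _ -> //; rewrite mulr0.
(* After normalization to (1,y,z), only the indicator of (y,z) contributes to the sum, and it
   cancels the value of g. *)
rewrite (meval_normalize fd v0); set y := v 1 / _; set z := v _ / _.
rewrite mevalB (raddf_sum (meval _)) (bigD1 (y, z)) //= big1 => [|st ne].
  rewrite mevalZ addr0; case: (eP (y, z)) => _ _ ->.
  by rewrite /= !eqxx mulr1 subrr mulr0.
rewrite mevalZ; case: (eP st) => _ _ ->.
by case: andP ne => [[/eqP -> /eqP ->]|]; rewrite ?mulr0 // -surjective_pairing eqxx.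
Qed.

End Forms.

(** * Sufficiency: separating forms in degree d0 ab with d0 >= q *)

Section Sufficiency.
Variables (F : finFieldType) (K : closedFieldType) (h : {rmorphism F -> K}).
Variables (a b : nat).
Hypotheses (ab : coprime a b) (a_gt1 : (1 < a)%N) (lt_ab : (a < b)%N).
Local Notation q := #|F|.

(** A point of the line is determined by which coordinates vanish and by the ratio x2^a : x1^b. *)
Lemma same_point_line (u v : 'rV[F]_3) :
    u 0 0 = 0 -> v 0 0 = 0 -> (v 0 1 == 0) = (u 0 1 == 0) ->
    (v 0 2%:R == 0) = (u 0 2%:R == 0) ->
    v 0 2%:R ^+ a * u 0 1 ^+ b = u 0 2%:R ^+ a * v 0 1 ^+ b ->
  same_point h a b u v.
Proof.
have a0 : (0 < a)%N by lia.
have b0 : (0 < b)%N by lia.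
move=> u0 v0 uv1 uv2 uv.
suff [l [l0 l1 l2]] : exists l : K, [/\ l != 0,
    h (v 0 1) = l ^+ a * h (u 0 1) & h (v 0 2%:R) = l ^+ b * h (u 0 2%:R)].
  by exists l => //; apply: ord3P; rewrite ?u0 ?v0 ?rmorph0 ?mulr0.
(* At the two coordinate points a single equation on l remains; it is solved by a root in [K]. *)
have root n (x y : F) : (0 < n)%N -> x != 0 -> y != 0 ->
    exists2 l : K, l != 0 & h y = l ^+ n * h x.
  move=> n0 x0 y0; have [l lE] := closed_root (h (y / x)) n0.
  exists l; last by rewrite lE -rmorphM divfK.
  apply: contraNneq (mulf_neq0 y0 (invr_neq0 x0)) => l0.
  by rewrite -(fmorph_eq0 h) -lE l0 expr0n (gtn_eqF n0).
have [u10|u10] := eqVneq (u 0 1) 0; have [u20|u20] := eqVneq (u 0 2%:R) 0.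
- move: uv1 uv2; rewrite u10 u20 !eqxx => /eqP -> /eqP ->.
  by exists 1; rewrite oner_neq0 rmorph0 !mulr0.
- have [|l l0 lE] := root b _ (v 0 2%:R) b0 u20; first by rewrite uv2.
  move: uv1; rewrite u10 eqxx => /eqP ->; exists l.
  by rewrite rmorph0 mulr0.
- have [|l l0 lE] := root a _ (v 0 1) a0 u10; first by rewrite uv1.
  move: uv2; rewrite u20 eqxx => /eqP ->; exists l.
  by rewrite rmorph0 mulr0.
(* Both coordinates are nonzero: equality of the ratios is the hypothesis of [bezout_pow] for the
   quotients of coordinates. *)
- have [|||l [l0 l1 l2]] := @bezout_pow F a b (v 0 1 / u 0 1) (v 0 2%:R / u 0 2%:R) a0 ab.
  + by rewrite mulf_neq0 ?invr_neq0 // uv1.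
  + by rewrite mulf_neq0 ?invr_neq0 // uv2.
  + rewrite !expr_div_n; apply/eqP; rewrite eqr_div ?expf_neq0 // uv mulrC; exact/eqP.
  exists (h l); split; first by rewrite fmorph_eq0.
    by rewrite -rmorphXn -rmorphM l1 divfK.
  by rewrite -rmorphXn -rmorphM l2 divfK.
Qed.

Lemma separating_form_line d0 (u : 'rV[F]_3) : (q <= d0)%N -> u != 0 -> u 0 0 = 0 ->
  exists g, [/\ graded_piece a b (d0 * a * b) g, g.@[u 0] != 0 &
    forall v : 'rV[F]_3, v != 0 -> v 0 0 = 0 -> ~ same_point h a b u v -> g.@[v 0] = 0].
Proof.
have q1 : (1 < q)%N := finNzRing_gt1 F.
have a0 : (0 < a)%N by lia.
have b0 : (0 < b)%N by lia.
have nz (v : 'rV[F]_3) : v != 0 -> v 0 0 = 0 -> v 0 1 = 0 -> v 0 2%:R = 0 -> False.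
  move=> /eqP v0 v00 v01 v02; apply: v0; apply/rowP.
  by apply: ord3P; rewrite mxE.
have hom1 n : ('X_1 ^+ n : {mpoly F[3]}) \is (a * n).-homog for (wdeg a b).
  exact: (dhomog_varX _ _ _ 1).
have hom2 n : ('X_(2%:R) ^+ n : {mpoly F[3]}) \is (b * n).-homog for (wdeg a b).
  exact: (dhomog_varX _ _ _ 2%:R).
move=> qd un0 u0.
have [u1|u1] := eqVneq (u 0 1) 0.
  (* Here [u] is (0:0:1). With U = x1^b and V = x2^a the form is V^d0 - V^(d0-q+1) U^(q-1),
     homogeneous of degree d0 ab, and [corner_form] gives its values. *)
  exists ('X_(2%:R) ^+ (a * d0) - 'X_(2%:R) ^+ (a * (d0 - q.-1)) * 'X_1 ^+ (b * q.-1)).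
  have gE (v : 'I_3 -> F) :
      ('X_(2%:R) ^+ (a * d0) - 'X_(2%:R) ^+ (a * (d0 - q.-1)) * 'X_1 ^+ (b * q.-1)).@[v]
      = (v 1 == 0)%:R * v 2%:R ^+ (a * d0).
    by rewrite mevalB mevalM !rmorphXn /= !mevalXU corner_form.
  split; rewrite ?gE.
  - apply: rpredB; first by have := hom2 (a * d0)%N; congr (_ \is _.-homog for _); lia.
    have := dhomogM (hom2 (a * (d0 - q.-1))%N) (hom1 (b * q.-1)%N).
    by congr (_ \is _.-homog for _); nia.
  - rewrite u1 eqxx mul1r expf_neq0 //; apply/eqP => u2.
    exact: (nz u).
  - move=> v vn0 v0 uv; rewrite gE; have [v1|v1] := eqVneq (v 0 1) 0; last by rewrite mul0r.
    case: uv; apply: same_point_line => //; rewrite ?u1 ?v1 ?eqxx //.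
      have [v2|v2] := eqVneq (v 0 2%:R) 0; first by case: (nz v).
      by have [u2|u2] := eqVneq (u 0 2%:R) 0; first by case: (nz u).
    by rewrite expr0n (gtn_eqF b0) !mulr0.
have [u2|u2] := eqVneq (u 0 2%:R) 0.
  (* The point (0:1:0), with U and V exchanged. *)
  exists ('X_1 ^+ (b * d0) - 'X_1 ^+ (b * (d0 - q.-1)) * 'X_(2%:R) ^+ (a * q.-1)).
  have gE (v : 'I_3 -> F) :
      ('X_1 ^+ (b * d0) - 'X_1 ^+ (b * (d0 - q.-1)) * 'X_(2%:R) ^+ (a * q.-1)).@[v]
      = (v 2%:R == 0)%:R * v 1 ^+ (b * d0).
    by rewrite mevalB mevalM !rmorphXn /= !mevalXU corner_form.
  split; rewrite ?gE.
  - apply: rpredB; first by have := hom1 (b * d0)%N; congr (_ \is _.-homog for _); lia.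
    have := dhomogM (hom1 (b * (d0 - q.-1))%N) (hom2 (a * q.-1)%N).
    by congr (_ \is _.-homog for _); nia.
  - by rewrite u2 eqxx mul1r expf_neq0.
  - move=> v vn0 v0 uv; rewrite gE; have [v2|v2] := eqVneq (v 0 2%:R) 0; last by rewrite mul0r.
    case: uv; apply: same_point_line => //; rewrite ?u2 ?v2 ?eqxx //.
      have [v1|v1] := eqVneq (v 0 1) 0; first by case: (nz v).
      by rewrite (negbTE u1).
    by rewrite expr0n (gtn_eqF a0) !mul0r.
(* [V / U] is a coordinate on the torus of the line, and [u] is the point [c];
   the last factor of the form vanishes at every other point of the torus and
   at [U = 0]. *)
pose c := u 0 2%:R ^+ a / u 0 1 ^+ b.
have c0 : c != 0 by rewrite mulf_neq0 ?invr_neq0 ?expf_neq0.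
pose U : {mpoly F[3]} := 'X_1 ^+ b.
pose V : {mpoly F[3]} := 'X_(2%:R) ^+ a.
have homU : U \is (a * b).-homog for (wdeg a b) by exact: hom1.
have homV : V \is (a * b).-homog for (wdeg a b) by rewrite mulnC; exact: hom2.
exists (U ^+ (d0 - q) * V * (V ^+ q.-1 - (V - c *: U) ^+ q.-1)).
have gE (v : 'I_3 -> F) : (U ^+ (d0 - q) * V * (V ^+ q.-1 - (V - c *: U) ^+ q.-1)).@[v] =
    v 1 ^+ (b * (d0 - q)) * v 2%:R ^+ a *
    ((v 2%:R != 0)%:R - (v 2%:R ^+ a != c * v 1 ^+ b)%:R).
  rewrite !mevalM !mevalB !rmorphXn /= mevalB mevalZ !rmorphXn /= !mevalXU -exprM.
  by rewrite !fermat_pred subr_eq0 expf_eq0 a0.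
split; rewrite ?gE.
- rewrite /graded_piece /=.
  have -> : (d0 * a * b = a * b * (d0 - q) + a * b + a * b * q.-1)%N by nia.
  apply: dhomogM; first by apply: dhomogM => //; exact: dhomogMn.
  by apply: rpredB; apply: dhomogMn => //; apply: rpredB => //; apply: rpredZ.
- rewrite /c divfK ?expf_neq0 // eqxx u2 subr0 mulr1.
  by rewrite mulf_neq0 ?expf_neq0.
- move=> v vn0 v0 uv; rewrite gE.
  (* Where V = 0 the last factor is -1, so the separate factor [V] is what kills the form. *)
  have [v2|v2] := eqVneq (v 0 2%:R) 0.
    by rewrite v2 expr0n (gtn_eqF a0) mulr0 mul0r.
  have [v2E|_] := eqVneq (v 0 2%:R ^+ a) (c * v 0 1 ^+ b); last by rewrite subrr mulr0.
  have v1 : v 0 1 != 0.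
    apply: contraNneq v2 => v1; move: v2E; rewrite v1 expr0n (gtn_eqF b0) mulr0.
    by move=> /eqP; rewrite expf_eq0 a0.
  case: uv; apply: same_point_line => //;
    rewrite ?(negbTE v1) ?(negbTE v2) ?(negbTE u1) ?(negbTE u2) //.
  by rewrite v2E mulrAC divfK ?expf_neq0.
Qed.

Lemma separating_form d0 (u : 'rV[F]_3) : (q <= d0)%N -> u != 0 ->
  exists f, [/\ graded_piece a b (d0 * a * b) f, f.@[u 0] != 0 &
    forall v : 'rV[F]_3, v != 0 -> ~ same_point h a b u v -> f.@[v 0] = 0].
Proof.
move=> qd un0; have dq := degree_bound a_gt1 lt_ab qd.
have [u0|u0] := eqVneq (u 0 0) 0.
  have [g [gd gu gv]] := separating_form_line qd un0 u0.
  have [f [fd f0 f1]] := line_extension dq gd.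
  exists f; split=> // [|v vn0 uv]; first by rewrite f0.
  by have [v0|/f1] := eqVneq (v 0 0) 0; [rewrite f0 // gv | apply].
have [f [fd f0 f1]] := affine_indicator (u 0 1 / u 0 0 ^+ a) (u 0 2%:R / u 0 0 ^+ b) dq.
exists f; split=> // [|v vn0 uv].
  by rewrite (meval_normalize fd u0) f1 !eqxx mulr1 expf_neq0.
have [/f0|v0] := eqVneq (v 0 0) 0; first by apply.
rewrite (meval_normalize fd v0) f1.
case: andP => [[/eqP e1 /eqP e2]|_]; last by rewrite mulr0.
(* Equal affine coordinates mean that [v] is [u] rescaled by the quotient of their
   x0-coordinates. *)
case: uv; exists (h (v 0 0 / u 0 0)).
  by rewrite fmorph_eq0 mulf_neq0 ?invr_neq0.
have conj n x y : x / v 0 0 ^+ n = y / u 0 0 ^+ n ->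
    h x = h (v 0 0 / u 0 0) ^+ n * h y.
  move=> e; rewrite -rmorphXn -rmorphM expr_div_n mulrAC -mulrA -e mulrC divfK //.
  exact: expf_neq0.
apply: ord3P; [by apply: (conj 1%N); rewrite !expr1 !divff | exact: conj | exact: conj].
Qed.

End Sufficiency.

(** * Necessity: divisibility of the degree and a root count on the line *)

Section Necessity.
Variables (F : finFieldType) (a b : nat).
Hypotheses (ab : coprime a b) (a_gt0 : (0 < a)%N) (b_gt0 : (0 < b)%N).
Local Notation q := #|F|.

Lemma meval_pt (f : {mpoly F[3]}) x y z :
  f.@[pt x y z] = \sum_(m <- msupp f)
    f@_m * (x ^+ m 0%R * y ^+ m 1%R * z ^+ m 2%:R).
Proof.
by rewrite mevalE; apply: eq_bigr => m _; rewrite big_ord3.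
Qed.

(** At a coordinate point only pure powers of that coordinate survive, and their degrees are
    multiples of its weight. *)
Lemma weight_dvd_degree d (f : {mpoly F[3]}) :
    graded_piece a b d f ->
  (f.@[pt 0 1 0] != 0 -> (a %| d)%N) /\ (f.@[pt 0 0 1] != 0 -> (b %| d)%N).
Proof.
move=> /dhomogP fd; split; apply: contraNT => nd; rewrite meval_pt;
  apply/eqP; apply: big1_seq => m /andP[_ /fd /=]; rewrite wdegE !expr0n expr1n => dm.
- have [m0|] := eqVneq (m 0) 0%N; last by rewrite !mul0r mulr0.
  have [m2|] := eqVneq (m 2%:R) 0%N; last by rewrite !mulr0.
  by move: nd; rewrite -dm m0 m2 mul0n add0n addn0 dvdn_mull.
- have [m0|] := eqVneq (m 0) 0%N; last by rewrite !mul0r mulr0.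
  have [m1|] := eqVneq (m 1) 0%N; last by rewrite mulr0 mul0r mulr0.
  by move: nd; rewrite -dm m0 m1 mul0n add0n dvdn_mull.
Qed.

(** Coprimality forces b | i and a | j. Thus the monomials of degree d0 ab in x1, x2 are the
    U^(d0-k) V^k with U = x1^b, V = x2^a. *)
Lemma weight_decomposition i j d0 : (i * a + j * b = d0 * a * b)%N ->
  exists2 k, (k <= d0)%N & i = ((d0 - k) * b)%N /\ j = (k * a)%N.
Proof.
move=> ijE.
have /dvdnP[k jk] : (a %| j)%N.
  rewrite -(Gauss_dvdl _ ab) -(dvdn_addr _ (dvdn_mull i (dvdnn a))) ijE.
  by rewrite mulnAC dvdn_mull.
have /dvdnP[k' ik] : (b %| i)%N.
  rewrite -(@Gauss_dvdl _ _ a); last by rewrite coprime_sym.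
  by rewrite -(dvdn_addl _ (dvdn_mull j (dvdnn b))) ijE dvdn_mull.
have kk : (k' + k = d0)%N.
  apply/eqP; rewrite -(eqn_pmul2r (m := a * b)) ?muln_gt0 ?a_gt0 //.
  by apply/eqP; rewrite [RHS]mulnA -ijE ik jk; nia.
by exists k; [lia | split=> //; rewrite ik -kk addnK].
Qed.

Lemma degree_lower_bound d0 (f : {mpoly F[3]}) :
    graded_piece a b (d0 * a * b) f -> f.@[pt 0 1 0] != 0 ->
  (forall y z, z != 0 -> f.@[pt 0 y z] = 0) -> (q <= d0)%N.
Proof.
move=> /dhomogP fd f1 f0.
(* By [weight_decomposition], the restriction of [f] to the line is a binary
   form of degree [d0] in [U = 'X_1 ^+ b] and [V = 'X_2 ^+ a]; [p] is its dehomogenization. *)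
pose p : {poly F} :=
  \sum_(m <- msupp f) (f@_m * 0 ^+ m 0%R) *: 'X^(m 2%:R %/ a).
have decomp (m : 'X_{1..3}) : m \in msupp f -> m 0 = 0%N ->
    exists2 k, (k <= d0)%N & m 1 = ((d0 - k) * b)%N /\ m 2%:R = (k * a)%N.
  move=> /fd; rewrite /= wdegE => + m0; rewrite m0 add0n.
  exact: weight_decomposition.
(* Since 0^0 = 1, the factor [0 ^+ m 0] keeps exactly the monomials without x0; hence p(0) =
   f(0,1,0). *)
have p0 : p.[0] != 0.
  rewrite horner_sum; apply: contraNneq f1 => e; apply/eqP.
  rewrite -[RHS]e meval_pt; apply: eq_big_seq => m mf; rewrite hornerZ hornerXn expr1n mulr1.
  have [m0|m0] := eqVneq (m 0) 0%N; last by rewrite !expr0n (negbTE m0) !(mul0r, mulr0).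
  have [k _ [_ ->]] := decomp m mf m0.
  by rewrite mulnK // -mulrA !expr0n muln_eq0 (gtn_eqF a_gt0) orbF.
(* The coefficient of degree d0 is f(0,0,1) = 0, and k <= d0 excludes higher ones. *)
have sp : (size p <= d0)%N.
  apply/leq_sizeP => j; rewrite leq_eqVlt coef_sum => /predU1P[<-|dj].
    rewrite -[RHS](f0 0 1 (oner_neq0 _)) meval_pt; apply: eq_big_seq => m mf.
    rewrite coefZ coefXn expr1n mulr1.
    have [m0|m0] := eqVneq (m 0) 0%N; last by rewrite !expr0n (negbTE m0) !(mul0r, mulr0).
    have [k kd [-> ->]] := decomp m mf m0.
    rewrite mulnK // -mulrA !expr0n muln_eq0 (gtn_eqF b_gt0) orbF subn_eq0.
    by rewrite [d0 == k]eqn_leq kd andbT.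
  apply: big1_seq => m /andP[_ mf]; rewrite coefZ coefXn.
  have [m0|m0] := eqVneq (m 0) 0%N; last by rewrite !expr0n (negbTE m0) !(mul0r, mulr0).
  have [k kd [_ ->]] := decomp m mf m0.
  by rewrite mulnK // (gtn_eqF (leq_ltn_trans kd dj)) mulr0.
have pc c : c != 0 -> root p c.
  move=> c0; case: (egcdnP b a_gt0) => i j; rewrite (eqP ab) => ij _.
  (* As ia = jb + 1, the point (0, c^j, c^i) has V/U = c, and f takes the value c^(jb d0) p(c)
     there. *)
  have := f0 (c ^+ j) (c ^+ i) (expf_neq0 _ c0).
  rewrite meval_pt => e; apply/eqP; apply: (mulfI (expf_neq0 (j * b * d0) c0)).
  rewrite mulr0 -[RHS]e horner_sum mulr_sumr; apply: eq_big_seq => m mf.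
  rewrite hornerZ hornerXn.
  have [m0|m0] := eqVneq (m 0) 0%N; last by rewrite !expr0n (negbTE m0) !(mul0r, mulr0).
  have [k kd [-> ->]] := decomp m mf m0.
  rewrite mulnK // mulrCA -!mulrA; do 2 congr (_ * _).
  rewrite -!exprM -!exprD; congr (c ^+ _).
  nia.
have pn0 : p != 0 by apply: contraNneq p0 => ->; rewrite horner0.
have := @max_poly_roots _ p (enum [pred c : F | c != 0]) pn0 _ (enum_uniq _).
rewrite -cardE => /(_ _).
have -> : #|[pred c : F | c != 0]| = q.-1.
  by rewrite -(cardC1 (0 : F)); apply: eq_card.
have q1 : (1 < q)%N := finNzRing_gt1 F.
(* The q - 1 nonzero elements are roots of p, so q - 1 < [size p] <= d0. *)
suff rts : all (root p) (enum [pred c : F | c != 0]).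
  by move=> /(_ rts) qp; rewrite -(prednK (ltnW q1)); exact: leq_trans qp sp.
by apply/allP => c; rewrite mem_enum => /pc.
Qed.

End Necessity.

(** * The two inclusions combined *)

Lemma regular_degree_multiple (F : finFieldType) (K : fieldType)
    (h : {rmorphism F -> K}) (a b : nat) d :
    coprime a b -> (0 < a)%N -> (0 < b)%N ->
  regularity_set h (rational_points h a b) d ->
  exists2 d0, (#|F| <= d0)%N & d = (d0 * a * b)%N.
Proof.
move=> ab a_gt0 b_gt0 /(regularity_setP h a_gt0 b_gt0) sep.
have row_pt (x y z : F) f : f.@[(\row_i pt x y z i : 'rV[F]_3) 0] = f.@[pt x y z].
  by apply: meval_eq => i; rewrite mxE.
have row_neq0 (x y z : F) i : pt x y z i != 0 -> \row_i pt x y z i != 0 :> 'rV[F]_3.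
  by apply: contraNneq => /rowP/(_ i); rewrite !mxE => ->.
have [f [fd f1 f0]] := sep _ (row_neq0 0 1 0 1 (oner_neq0 F)).
have [g [gd g1 _]] := sep _ (row_neq0 0 0 1 2%:R (oner_neq0 F)).
rewrite row_pt in f1; rewrite row_pt in g1.
have : (a * b %| d)%N.
  by rewrite Gauss_dvd // (proj1 (weight_dvd_degree fd) f1) (proj2 (weight_dvd_degree gd) g1).
move=> /dvdnP[d0]; rewrite mulnA => dE; exists d0 => //.
rewrite dE in fd; apply: degree_lower_bound fd f1 _ => // y z z0.
rewrite -row_pt; apply: f0; first exact: (row_neq0 0 y z 2%:R).
(* Rescaling (0,1,0) keeps its last coordinate zero, so (0,y,z) with z != 0 is another point. *)
move=> [l _ /(_ 2%:R)]; rewrite !mxE /pt /tnth /= rmorph0 mulr0.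
by move/eqP; rewrite fmorph_eq0 (negbTE z0).
Qed.

Theorem theorem3p4 (q : nat) (F : finFieldType) (hq : #|F| = q)
    (K : closedFieldType) (iota : {rmorphism F -> K})
    (hK : integralRange iota)
    (a b : nat) (hab : coprime a b) (ha : (1 < a)%N) (hb : (a < b)%N) :
  regularity_set iota (rational_points iota a b)
    = [set d : nat | exists d0 : nat, (q <= d0)%N /\ d = (d0 * a * b)%N] /\
  [set d : nat | exists d0 : nat, (q <= d0)%N /\ d = (d0 * a * b)%N]
    = [set d : nat | exists n : nat, d = (q * a * b + n * (a * b))%N].
Proof.
have a_gt0 : (0 < a)%N := ltnW ha.
have b_gt0 : (0 < b)%N := ltn_trans a_gt0 hb.
rewrite -hq; split; apply/seteqP; split=> d.
- by move=> /regular_degree_multiple[] // d0 qd ->; exists d0.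
- move=> [d0 [qd ->]]; apply/regularity_setP => // u u0.
  exact: separating_form.
- move=> [d0 [qd ->]]; exists (d0 - #|F|)%N.
  by rewrite -[in LHS](subnKC qd) !mulnDl -!mulnA.
- move=> [n ->]; exists (#|F| + n)%N; rewrite leq_addr; split=> //.
  by rewrite !mulnDl mulnA.
Qed.
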